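(* Let $k$ be a field and let $T$ be a totally ordered set. Every isomorphism class of indecomposable injective objects of $\operatorname{Mod} kT$ is uniquely determined by its support, and the support map restricts to a bijection $$\operatorname{supp}\colon \operatorname{Sp} T\longrightarrow\operatorname{Idl} T$$ from the set $\operatorname{Sp} T$ of (representatives of) isomorphism classes of indecomposable injective objects of $\operatorname{Mod} kT$ to the set of ideals of $T$. Its inverse $\Delta$ sends an ideal $I$ to (the isomorphism class of) the interval representation $k_I$.
   Context: $\operatorname{Mod} kT$ is the category of functors from $T$ (viewed as a category with a unique morphism $x\to y$ whenever $x\le y$) to $k$-vector spaces. The support of $M$ is $\operatorname{supp} M=\{t\in T\mid M_t\ne 0\}$. An ideal of $T$ is a nonempty subset $I\subseteq T$ such that $x\le y$ and $y\in I$ imply $x\in I$; $\operatorname{Idl} T$ is the set of ideals of $T$. For an ideal $I$, $k_I$ is the representation with $k_I(p)=k$ for $p\in I$, $k_I(p)=0$ for $p\notin I$, and $k_I(p\le q)=\mathrm{id}_k$ for $p\le q$ in $I$. *)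

(* Defs.v *)
From HB Require Import structures.
From mathcomp Require Import all_boot all_order all_algebra.
From mathcomp Require Import boolp classical_sets functions.

Set Implicit Arguments.
Unset Strict Implicit.
Unset Printing Implicit Defensive.
Import Order.TTheory GRing.Theory.
Local Open Scope classical_set_scope.
Local Open Scope ring_scope.

(* Objects of [Mod kT]: functors from the thin category [T] to [k]-vector
   spaces.  The order is boolean, so the proof argument of [rep_map] is
   irrelevant and hom-sets of [T] have at most one element. *)
Record rep (k : fieldType) d (T : orderType d) := Rep {
  rep_obj :> T -> lmodType k;
  rep_map : forall x y : T, (x <= y)%O -> {linear rep_obj x -> rep_obj y};
  rep_map_id : forall (x : T) (xx : (x <= x)%O) (v : rep_obj x),
    rep_map xx v = v;
  rep_map_comp : forall (x y z : T) (xy : (x <= y)%O) (yz : (y <= z)%O)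
      (xz : (x <= z)%O) (v : rep_obj x),
    rep_map xz v = rep_map yz (rep_map xy v) }.
Arguments rep_map {k d T} _ {x y} _.

Record hom (k : fieldType) d (T : orderType d) (M N : rep k T) := Hom {
  hom_fun :> forall t : T, {linear M t -> N t};
  hom_nat : forall (x y : T) (xy : (x <= y)%O) (v : M x),
    hom_fun y (rep_map M xy v) = rep_map N xy (hom_fun x v) }.

Section Representations.
Context {k : fieldType} {d : Order.disp_t} {T : orderType d}.
Implicit Types M N A B C : rep k T.

Definition isomorphic M N : Prop :=
  exists (f : hom M N) (g : hom N M),
    (forall t, cancel (f t) (g t)) /\ (forall t, cancel (g t) (f t)).

Definition monomorphism A B (f : hom A B) : Prop :=
  forall C (u v : hom C A),
    (forall t, f t \o u t =1 f t \o v t) -> forall t, u t =1 v t.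

Definition injective_object M : Prop :=
  forall A B (f : hom A B), monomorphism f ->
  forall g : hom A M, exists h : hom B M, forall t, h t \o f t =1 g t.

Definition zero_space (V : lmodType k) : Prop := forall v : V, v = 0.

Definition zero_object M : Prop := forall t, zero_space (M t).

Section DirectSum.
Variables A B : rep k T.

Definition dsum_map_fun x y (xy : (x <= y)%O) (v : A x * B x) : A y * B y :=
  (rep_map A xy v.1, rep_map B xy v.2).

Fact dsum_map_linear x y (xy : (x <= y)%O) : linear (dsum_map_fun xy).
Proof. by move=> a u v; rewrite /dsum_map_fun !linearP. Qed.

HB.instance Definition _ x y (xy : (x <= y)%O) :=
  GRing.isLinear.Build k (A x * B x)%type (A y * B y)%type _
    (dsum_map_fun xy) (dsum_map_linear xy).

Definition dsum : rep k T.
Proof.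
refine (@Rep k d T (fun t => (A t * B t)%type : lmodType k)
  (fun x y xy => dsum_map_fun xy) _ _).
- by move=> x xx [a b]; rewrite /= /dsum_map_fun /= !rep_map_id.
- move=> x y z xy yz xz [a b]; rewrite /= /dsum_map_fun /=.
  by rewrite (rep_map_comp xy yz xz a) (rep_map_comp xy yz xz b).
Defined.

End DirectSum.

Definition indecomposable M : Prop :=
  ~ zero_object M /\
  forall A B, isomorphic M (dsum A B) -> zero_object A \/ zero_object B.

Definition supp M : set T := [set t | ~ zero_space (M t)].

End Representations.

(* A point of [Sp T] is an isomorphism class, i.e. the predicate of being
   isomorphic to some fixed indecomposable injective object.  A plain predicate
   is used because [rep k T] is too large a type for [set]. *)
Record Sp (k : fieldType) d (T : orderType d) := MkSp {
  Sp_class :> rep k T -> Prop;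
  Sp_classP : exists M : rep k T,
    [/\ injective_object M, indecomposable M & Sp_class = isomorphic M] }.
Arguments Sp k {d} T.

Record Idl d (T : orderType d) := MkIdl {
  Idl_set :> set T;
  Idl_neq0 : Idl_set !=set0;
  Idl_down : forall x y : T, (x <= y)%O -> Idl_set y -> Idl_set x }.
Arguments Idl {d} T.

Section Interval.
Context (k : fieldType) {d : Order.disp_t} {T : orderType d}.

Definition line (b : bool) : lmodType k :=
  if b then (k^o : lmodType k) else ('rV[k]_0 : lmodType k).

Definition line_map (b c : bool) : {linear line b -> line c} :=
  match b, c return {linear line b -> line c} with
  | true, true => idfun
  | _, _ => \0
  end.

Definition interval_rep (I : Idl T) : rep k T.
Proof.
refine (@Rep k d T (fun t => line (t \in Idl_set I))
  (fun x y _ => line_map (x \in Idl_set I) (y \in Idl_set I)) _ _).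
- by move=> x _; case: (x \in _) => //= v; rewrite [v]thinmx0.
- move=> x y z xy yz _.
  have : (z \in Idl_set I) ==> (y \in Idl_set I).
    by apply/implyP => /set_mem Iz; apply/mem_set; exact: Idl_down Iz.
  by case: (x \in _) (y \in _) (z \in _) => [] [] []; rewrite //= linear0.
Defined.

End Interval.

(* Main.v *)
From Pilot Require (* [hom] must not denote MathComp's space of linear maps. *)
Import Defs.
From HB Require Import structures.
From mathcomp Require Import all_boot all_order all_algebra.
From mathcomp Require Import boolp classical_sets functions.
Import Defs.
Set Implicit Arguments.
Unset Strict Implicit.
Unset Printing Implicit Defensive.
Import Order.TTheory GRing.Theory.
Local Open Scope classical_set_scope.
Local Open Scope ring_scope.

(** [Hom(B, k_I)] is the dual of [colim_I B]; since the ideal [I] is directed,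
    this colimit is exact, so [k_I] is injective.  Instead of forming the colimit,
    a cocone on a subobject is extended by Zorn's lemma applied to graphs of
    partial cocones.  [k_I] is indecomposable since its stalks are at most
    one-dimensional and its structure maps are injective inside [I].

    Conversely, let [M] be indecomposable injective and [v <> 0] in [M_t].  The
    points which are not above [t], or up to which [v] survives, form an ideal
    [I], and the subobject of [M] generated by [v] is the part of [k_I] above
    [t].  By injectivity of [M] its inclusion extends to [k_I -> M], which is
    again mono because the part above [t] is essential in [k_I].  As [k_I] is
    injective it splits off, so [M] is isomorphic to [k_I]. *)

(** * Kernels of linear maps as vector spaces *)

Section LinearKernel.
Context {k : fieldType} {V W : lmodType k} (f : {linear V -> W}).

Definition lin_ker : {pred V} := [pred v | f v == 0].

Fact lin_ker_submod : submod_closed lin_ker.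
Proof.
split=> [|a u v]; rewrite !inE ?linear0 // => /eqP fu /eqP fv.
by rewrite linearP fu fv scaler0 addr0.
Qed.

HB.instance Definition _ := GRing.isSubmodClosed.Build k V lin_ker lin_ker_submod.

Definition lin_ker_type : Type := {v : V | v \in lin_ker}.
HB.instance Definition _ := SubChoice.on lin_ker_type.
HB.instance Definition _ := [SubChoice_isSubLmodule of lin_ker_type by <:].

Definition in_lin_ker v (fv : f v = 0) : lin_ker_type :=
  exist (fun w => w \in lin_ker) v (introT eqP fv).

Lemma lin_ker_valP (v : lin_ker_type) : f (val v) = 0.
Proof. exact/eqP/(valP v). Qed.

End LinearKernel.

Definition linear_of {k : fieldType} {V W : lmodType k} (f : V -> W)
  (lf : linear f) : {linear V -> W} := HB.pack f (GRing.isLinear.Build k V W _ f lf).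

(** * Coordinates on spaces of dimension at most one *)

Section Line.
Context {k : fieldType}.

(** Coordinates in [k] replace case analysis on the dependent type [line k b]; on the zero space the
    coordinate is [0]. *)
Definition line_val {b : bool} : line k b -> k :=
  if b return line k b -> k then id else fun=> 0.

Definition line_of {b : bool} : k -> line k b :=
  if b return k -> line k b then id else fun=> 0.

Lemma line_valP b (a : k) (u v : line k b) :
  line_val (a *: u + v) = a * line_val u + line_val v.
Proof. by case: b u v => //= u v; rewrite mulr0 addr0. Qed.

Lemma line_val0 b : line_val (0 : line k b) = 0.
Proof. by case: b. Qed.

Lemma line_val_inj b : injective (@line_val b).
Proof. by case: b => //= u v _; rewrite [u]thinmx0 [v]thinmx0. Qed.

Lemma line_ofK (b : bool) (c : k) : b -> line_val (line_of c : line k b) = c.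
Proof. by case: b. Qed.

Lemma line_val_map (b c : bool) (v : line k b) :
  c -> line_val (line_map k b c v) = line_val v.
Proof. by case: b c v => -[]. Qed.

Lemma line_val_false b (v : line k b) : ~~ b -> line_val v = 0.
Proof. by case: b v. Qed.

(** This is the form in which dimension at most one enters the proof that [k_I] is
    indecomposable. *)
Lemma line_val_scale b (u v : line k b) : line_val u *: v = line_val v *: u.
Proof.
by case: b u v => /= u v; [exact: mulrC | rewrite [u]thinmx0 [v]thinmx0].
Qed.

Lemma line_map_id b (v : line k b) : line_map k b b v = v.
Proof. by case: b v => //= v; rewrite [v]thinmx0. Qed.

Lemma line_map_comp (a b c : bool) (v : line k a) : (a && c -> b) ->
  line_map k a c v = line_map k b c (line_map k a b v).
Proof. by case: a b c v => -[] [] //= v; [move/(_ isT) | rewrite linear0..]. Qed.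

Lemma zero_line b : zero_space (line k b) <-> ~~ b.
Proof.
split=> [|/negbTE -> v]; last by rewrite [v]thinmx0.
by case: b => // /(_ 1) /eqP; rewrite oner_eq0.
Qed.

End Line.

(** * Morphisms, isomorphisms and kernels of representations *)

Section Representations.
Context {k : fieldType} {d : Order.disp_t} {T : orderType d}.
Implicit Types (M N A B C : rep k T) (I J : Idl T).

Definition id_hom M : hom M M := @Hom k d T M M (fun t => idfun) (fun _ _ _ _ => erefl).

Definition comp_hom A B C (g : hom B C) (f : hom A B) : hom A C.
Proof.
refine (@Hom k d T A C (fun t => g t \o f t : {linear A t -> C t}) _).
by move=> x y xy v /=; rewrite !hom_nat.
Defined.

Definition zero_hom A B : hom A B.
Proof.
refine (@Hom k d T A B (fun t => \0) _).
by move=> x y xy v /=; rewrite linear0.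
Defined.

Lemma isomorphic_refl M : isomorphic M M.
Proof. by exists (id_hom M), (id_hom M). Qed.

Lemma isomorphic_sym M N : isomorphic M N -> isomorphic N M.
Proof. by move=> [f [g [fK gK]]]; exists g, f. Qed.

Lemma isomorphic_trans M N C :
  isomorphic M N -> isomorphic N C -> isomorphic M C.
Proof.
move=> [f [g [fK gK]]] [f' [g' [fK' gK']]].
by exists (comp_hom f' f), (comp_hom g g'); split=> t v /=;
  rewrite (fK', gK) (fK, gK').
Qed.

Lemma isomorphic_class M N : isomorphic M N -> isomorphic M = isomorphic N.
Proof.
move=> MN; apply: funext => C; apply: propext; split.
  exact/isomorphic_trans/isomorphic_sym.
exact/isomorphic_trans.
Qed.

Lemma isomorphic_supp M N : isomorphic M N -> supp M = supp N.
Proof.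
move=> [f [g [fK gK]]]; apply/seteqP; split=> t /= MN0 z0; apply: MN0 => v.
  by rewrite -(fK t v) (z0 (f t v)) linear0.
by rewrite -(gK t v) (z0 (g t v)) linear0.
Qed.

Section Kernel.
Context {A B} (f : hom A B).

Fact ker_map_subproof x y (xy : (x <= y)%O) (v : lin_ker_type (f x)) :
  f y (rep_map A xy (val v)) = 0.
Proof. by rewrite hom_nat lin_ker_valP linear0. Qed.

Definition ker_map x y (xy : (x <= y)%O) (v : lin_ker_type (f x)) :
  lin_ker_type (f y) := in_lin_ker (ker_map_subproof xy v).

Fact ker_map_linear x y (xy : (x <= y)%O) : linear (ker_map xy).
Proof. by move=> a u v; apply: val_inj; rewrite /= linearP. Qed.

Definition ker_rep : rep k T.
Proof.
refine (@Rep k d T (fun t => lin_ker_type (f t) : lmodType k)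
  (fun x y xy => linear_of (ker_map_linear xy)) _ _).
- by move=> x xx v; apply: val_inj; rewrite /= rep_map_id.
- by move=> x y z xy yz xz v; apply: val_inj; rewrite /= (rep_map_comp xy yz).
Defined.

Fact ker_val_linear t : linear (val : lin_ker_type (f t) -> A t).
Proof. by []. Qed.

Definition ker_incl : hom ker_rep A.
Proof.
by refine (@Hom k d T ker_rep A (fun t => linear_of (ker_val_linear (t := t))) _).
Defined.

End Kernel.

(** The inclusion of the kernel and the zero morphism agree after composition with [f], so the
    kernel vanishes. *)
Lemma monomorphism_injective A B (f : hom A B) :
  monomorphism f -> forall t, injective (f t).
Proof.
move=> fM t u v fuv; apply/eqP; rewrite -subr_eq0; apply/eqP.
have uvP : f t (u - v) = 0 by rewrite linearB fuv subrr.
apply: (fM (ker_rep f) (ker_incl f) (zero_hom _ _) _ t (in_lin_ker uvP)) => s w /=.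
by rewrite lin_ker_valP linear0.
Qed.

Lemma injective_monomorphism A B (f : hom A B) :
  (forall t, injective (f t)) -> monomorphism f.
Proof. by move=> fi C u v fuv t x; apply/(fi t)/fuv. Qed.

(** * Extension of cocones by Zorn's lemma *)

Section Extension.
Context {A B : rep k T} (f : hom A B) (I : Idl T).
Hypothesis f_inj : forall t, injective (f t).
Variable g : forall t, A t -> k.
Hypothesis g_lin : forall t a (u v : A t), g (a *: u + v) = a * g u + g v.
Hypothesis g_nat : forall x y (xy : (x <= y)%O) (a : A x),
  Idl_set I y -> g (rep_map A xy a) = g a.

(* The graph of a partially defined cocone from [B] restricted to [I] to the
   vertex [k], whose domain may not be closed under preimages along [B]. *)
Record partial_cocone (G : forall t, B t -> k -> Prop) : Prop := PartialCocone {
  pc_sub : forall t b c, G t b c -> Idl_set I t;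
  pc_lin : forall t a u v x y,
    G t u x -> G t v y -> G t (a *: u + v) (a * x + y);
  pc_map : forall x y (xy : (x <= y)%O) b c,
    Idl_set I y -> G x b c -> G y (rep_map B xy b) c;
  pc_fun : forall t c, G t 0 c -> c = 0 }.

(** Closes the domain under preimages along [B]: [b] receives the value of any of its later
    images. *)
Definition saturate (G : forall t, B t -> k -> Prop) t (b : B t) (c : k) :=
  exists s (ts : (t <= s)%O), G s (rep_map B ts b) c.

Lemma sub_saturate G : forall t b c, G t b c -> saturate G b c.
Proof. by move=> t b c Gb; exists t, (lexx t); rewrite rep_map_id. Qed.

(** Two elements at [t] get their values at points [s] and [r]; as [T] is total, both values can be
    moved to the larger of the two. *)
Lemma partial_cocone_saturate G :
  partial_cocone G -> partial_cocone (saturate G).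
Proof.
move=> [Gsub Glin Gmap Gfun]; split.
- by move=> t b c [s [ts /Gsub]]; apply: Idl_down.
- move=> t a u v x y [s [ts Gs]] [r [tr Gr]].
  wlog sr : a u v x y s ts Gs r tr Gr / (s <= r)%O.
    move=> W; have [sr|/ltW rs] := leP s r; first exact: (W a u v x y s ts Gs r tr).
    exists s, ts; rewrite linearP; apply: Glin => //.
    by rewrite (rep_map_comp tr rs); apply: Gmap => //; apply: Gsub Gs.
  exists r, tr; rewrite linearP; apply: Glin => //.
  by rewrite (rep_map_comp ts sr); apply: Gmap => //; apply: Gsub Gr.
- move=> x y xy b c Iy [s [xs Gs]]; have [ys|/ltW sy] := leP y s.
    by exists s, ys; rewrite -(rep_map_comp xy ys xs).
  by exists y, (lexx y); rewrite rep_map_id (rep_map_comp xs sy); apply: Gmap.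
- by move=> t c [s [ts]]; rewrite linear0; apply: Gfun.
Qed.

Definition image_graph t (b : B t) (c : k) :=
  Idl_set I t /\ exists2 a, b = f t a & c = g a.

Let g0 t : g (0 : A t) = 0.
Proof. by have := g_lin (-1) (0 : A t) 0; rewrite scaler0 addr0 mulN1r addNr. Qed.

Lemma image_graph0 t : Idl_set I t -> image_graph (0 : B t) 0.
Proof. by move=> It; split=> //; exists 0; rewrite ?linear0. Qed.

Lemma partial_cocone_image : partial_cocone image_graph.
Proof.
split.
- by move=> t b c [].
- move=> t a _ _ _ _ [It [u -> ->]] [_ [v -> ->]]; split=> //.
  by exists (a *: u + v); rewrite ?linearP ?g_lin.
- move=> x y xy _ _ Iy [_ [a -> ->]]; split=> //.
  by exists (rep_map A xy a); rewrite ?hom_nat ?g_nat.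
- move=> t _ [It [a fa ->]]; suff -> : a = 0 by [].
  by apply: f_inj; rewrite linear0.
Qed.

(** Adds the span of the images of [b0], all with value [0]. Only points above [t0] are covered;
    saturation recovers the values of [G] below. *)
Definition adjoin (G : forall t, B t -> k -> Prop) t0 (b0 : B t0) t (b : B t)
    (c : k) :=
  exists (tt : (t0 <= t)%O) (l : k), G t (b - l *: rep_map B tt b0) c.

Lemma partial_cocone_adjoin G t0 (b0 : B t0) :
    partial_cocone G -> (forall c, ~ saturate G b0 c) ->
  partial_cocone (adjoin G b0).
Proof.
move=> [Gsub Glin Gmap Gfun] b0G; split.
- by move=> t b c [tt [l /Gsub]].
- move=> t a u v x y [tt [l Gl]] [tt' [m Gm]]; exists tt, (a * l + m).
  have -> : a *: u + v - (a * l + m) *: rep_map B tt b0 =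
            a *: (u - l *: rep_map B tt b0) + (v - m *: rep_map B tt b0).
    by rewrite scalerDl -scalerA scalerBr opprD addrACA.
  by apply: Glin => //; rewrite (bool_irrelevance tt tt').
- move=> x y xy b c Iy [tt [l Gl]]; exists (le_trans tt xy), l.
  by rewrite (rep_map_comp tt xy) -linearZ -linearB; apply: Gmap.
- move=> t c [tt [l]]; rewrite sub0r => Gl.
  have [l0|l0] := eqVneq l 0.
    by move: Gl; rewrite l0 scale0r oppr0 => /Gfun.
  have G0 : G t 0 0.
    have := Glin _ (-1) _ _ _ _ Gl Gl.
    by rewrite scaleN1r mulN1r !addNr.
  (* For [l != 0], dividing by [- l] would give the image of [b0] at [t] a value, hence [b0] a value
     in the saturation. *)
  case: (b0G (- l^-1 * c)); exists t, tt.
  have := Glin _ (- l^-1) _ _ _ _ Gl G0.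
  by rewrite scalerN scaleNr opprK scalerA mulVf // scale1r !addr0.
Qed.

Lemma maximal_cocone : exists2 G, partial_cocone G &
  (forall t b c, image_graph b c -> G t b c) /\
  forall H, partial_cocone H -> (forall t b c, G t b c -> H t b c) ->
    forall t b c, H t b c -> G t b c.
Proof.
pose W := {t : T & (B t * k)%type}.
pose rel (X : set W) t b c := X (existT _ t (b, c)).
pose good X := partial_cocone (rel X) /\
  forall t b c, image_graph b c -> rel X t b c.
pose P X := X !=set0 -> good X.
have [F FP Ftot|G [PG Gmax]] := @Zorn_bigcup W P.
  move=> [w0 [X0 FX0 X0w0]].
  have Fgood X w : F X -> X w -> good X by move=> FX Xw; apply: FP => //; exists w.
  have [X0c X0i] := Fgood _ _ FX0 X0w0.
  split; last by move=> t b c /X0i X0b; exists X0.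
  split.
  - by move=> t b c [X FX Xb]; have [[+ _ _ _] _] := Fgood _ _ FX Xb; apply; exact: Xb.
  - move=> t a u v x y [X FX Xu] [Y FY Yv].
    case: (Ftot _ _ FX FY) => XY.
    + have [[_ Ylin _ _] _] := Fgood _ _ FY Yv.
      by exists Y => //; apply: Ylin => //; apply: XY.
    + have [[_ Xlin _ _] _] := Fgood _ _ FX Xu.
      by exists X => //; apply: Xlin => //; apply: XY.
  - move=> x y xy b c Iy [X FX Xb]; exists X => //.
    by have [[_ _ + _] _] := Fgood _ _ FX Xb; apply.
  - move=> t c [X FX Xb].
    by have [[_ _ _ +] _] := Fgood _ _ FX Xb; apply; exact: Xb.
pose graph (H : forall t, B t -> k -> Prop) : set W :=
  [set w | H (projT1 w) (projT2 w).1 (projT2 w).2].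
have Gn0 : G !=set0.
  (* The graph of the image contains [0] at any point of [I], so it would properly extend an empty
     maximal element. *)
  apply/set0P/eqP => G0; apply: (Gmax (graph image_graph)); last first.
    by move=> _; split=> //; apply: partial_cocone_image.
  rewrite G0; split; first by [].
  have [t It] := Idl_neq0 I.
  by move/(_ (existT _ t (0, 0))); apply; apply: image_graph0.
have [Gc Gi] := PG Gn0.
exists (rel G) => //; split=> // H Hc GH t b c Hb.
apply: contrapT => nGb; apply: (Gmax (graph H)).
  split; first by move=> [s [v e]] /GH.
  by move/(_ (existT _ t (b, c)) Hb).
by move=> _; split=> // s v e /Gi /GH.
Qed.

(** A maximal partial cocone equals its saturation and is defined on all of [B] over [I], since a
    missing element could be adjoined. *)
Lemma extend_cocone : exists h : forall t, B t -> k,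
  [/\ forall t a u v, Idl_set I t -> h t (a *: u + v) = a * h t u + h t v,
      forall x y (xy : (x <= y)%O) b, Idl_set I y -> h y (rep_map B xy b) = h x b
    & forall t a, Idl_set I t -> h t (f t a) = g a].
Proof.
have [G Gc [Gi Gmax]] := maximal_cocone.
have [Gsub Glin Gmap Gfun] := Gc.
have Gsat t (b : B t) c : saturate G b c -> G t b c.
  by apply: (Gmax _ (partial_cocone_saturate Gc)); apply: sub_saturate.
have G00 t : Idl_set I t -> G t 0 0.
  by move=> It; apply/Gi/image_graph0.
have Gtot t (b : B t) : Idl_set I t -> exists c, G t b c.
  move=> It; apply: contrapT => nG.
  have bG c : ~ saturate G b c by move=> /Gsat Gb; apply: nG; exists c.
  apply: nG; exists 0.
  apply: (Gmax _ (partial_cocone_saturate (partial_cocone_adjoin Gc bG))); last first.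
    exists t, (lexx t), (lexx t), 1.
    by rewrite scale1r rep_map_id subrr; apply: G00.
  (* The enlarged cocone contains [G]: take the multiple [0] of [b], after moving [v] up to [t] if
     [s] lies below [t]. *)
  move=> s v c Gv; have [ts|/ltW st] := leP t s.
    by exists s, (lexx s), ts, 0; rewrite rep_map_id scale0r subr0.
  by exists t, st, (lexx t), 0; rewrite scale0r subr0; apply: Gmap.
(* The default [0] is used only off [I], where [G] has no values. *)
pose h t b := xget 0 [set c | G t b c].
have hP t b : Idl_set I t -> G t b (h t b).
  by move=> /(Gtot _ b) [c Gb]; apply: (xgetI 0 Gb).
have hE t b c : G t b c -> h t b = c.
  (* The difference of two values of [b] is a value of [0]. *)
  move=> Gb; apply/eqP; rewrite -subr_eq0 addrC; apply/eqP/(Gfun t).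
  have := Glin _ (-1) _ _ _ _ Gb (hP _ b (Gsub _ _ _ Gb)).
  by rewrite scaleN1r addNr mulN1r.
exists h; split.
- by move=> t a u v It; apply/hE/Glin; apply: hP.
- move=> x y xy b Iy; apply/hE/Gmap => //; apply: hP.
  exact: Idl_down Iy.
- by move=> t a It; apply/hE/Gi; split=> //; exists a.
Qed.

End Extension.

(** * Injectivity, support and indecomposability of [k_I] *)

Lemma line_val_interval_map I x y (xy : (x <= y)%O) (v : interval_rep k I x) :
  Idl_set I y -> line_val (rep_map (interval_rep k I) xy v) = line_val v.
Proof. by move/mem_set => Iy; apply: line_val_map Iy. Qed.

Lemma line_val_out I t (v : interval_rep k I t) :
  ~ Idl_set I t -> line_val v = 0.
Proof. by move=> nIt; apply/line_val_false/negP => /set_mem. Qed.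

Lemma interval_val_inj I t (u v : interval_rep k I t) :
  (Idl_set I t -> line_val u = line_val v) -> u = v.
Proof.
move=> uv; apply: line_val_inj; have [/uv //|nIt] := pselect (Idl_set I t).
by rewrite !line_val_out.
Qed.

(** In coordinates, a morphism to [k_I] is a cocone over [I] with vertex [k], which [extend_cocone]
    extends along [f]; off [I] the target is zero. *)
Lemma injective_interval_rep I : injective_object (interval_rep k I).
Proof.
move=> A B f /monomorphism_injective f_inj g.
have g_lin t a (u v : A t) :
    line_val (g t (a *: u + v)) = a * line_val (g t u) + line_val (g t v).
  by rewrite linearP line_valP.
have g_nat x y (xy : (x <= y)%O) (a : A x) : Idl_set I y ->
    line_val (g y (rep_map A xy a)) = line_val (g x a).
  by move=> Iy; rewrite hom_nat line_val_interval_map.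
have [h [h_lin h_nat hf]] := extend_cocone f_inj g_lin g_nat.
pose H t b : interval_rep k I t := line_of (h t b).
have HE t b : Idl_set I t -> line_val (H t b) = h t b.
  by move/mem_set; apply: line_ofK.
have H_lin t : linear (H t).
  move=> a u v; apply: interval_val_inj => It.
  by rewrite line_valP !HE // h_lin.
have H_nat x y (xy : (x <= y)%O) (b : B x) :
    H y (rep_map B xy b) = rep_map (interval_rep k I) xy (H x b).
  apply: interval_val_inj => Iy; have Ix := Idl_down xy Iy.
  by rewrite line_val_interval_map // !HE // h_nat.
exists (@Hom k d T B (interval_rep k I) (fun t => linear_of (H_lin t)) H_nat).
by move=> t a; apply: interval_val_inj => It; rewrite /= HE // hf.
Qed.

Lemma supp_interval_rep I : supp (interval_rep k I) = Idl_set I.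
Proof.
apply/seteqP; split=> t /=.
  by move=> nz; apply: contrapT => nIt; apply/nz/zero_line/negP => /set_mem.
by move=> It /zero_line; rewrite mem_set.
Qed.

Lemma interval_rep_nonzero I : ~ zero_object (interval_rep k I).
Proof.
have [t It] := Idl_neq0 I.
by move=> /(_ t) /zero_line; rewrite mem_set.
Qed.

(** Nonzero elements of [A] and [B] both live over [I]. The one at the earlier point stays nonzero
    at the later one, giving two independent vectors in a stalk of dimension at most one. *)
Lemma indecomposable_interval_rep I : indecomposable (interval_rep k I).
Proof.
split; first exact: interval_rep_nonzero.
move=> A B [f [g [fK gK]]].
have dim_le1 t (a : A t) (b : B t) : a = 0 \/ b = 0.
  pose u := line_val (g t (a, 0)); pose v := line_val (g t (0, b)).
  have : v *: g t (a, 0) = u *: g t (0, b) by apply: line_val_scale.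
  rewrite -!linearZ => /(congr1 (f t)); rewrite !gK => -[_].
  rewrite scaler0 => /esym/eqP; rewrite scaler_eq0 => /orP[/eqP u0|/eqP]; last by right.
  left; have : g t (a, 0) = 0 by apply: line_val_inj; rewrite line_val0.
  by move/(congr1 (f t)); rewrite gK linear0 => -[].
have inj s t (st : (s <= t)%O) (x : dsum A B s) :
    Idl_set I t -> rep_map (dsum A B) st x = 0 -> x = 0.
  move=> It x0; rewrite -(gK s x).
  suff -> : g s x = 0 by rewrite linear0.
  apply: line_val_inj; move: (congr1 (g t) x0).
  rewrite linear0 hom_nat => /(congr1 line_val).
  by rewrite line_val_interval_map // !line_val0.
have suppI t (x : dsum A B t) : x <> 0 -> Idl_set I t.
  apply: contra_notP => nIt; rewrite -(gK t x).
  suff -> : g t x = 0 by rewrite linear0.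
  by apply: line_val_inj; rewrite line_val_out // line_val0.
apply: contrapT => /not_orP[/existsNP[s /existsNP[a a0]] /existsNP[t /existsNP[b b0]]].
have a0' : (a, 0) <> 0 :> dsum A B s by case.
have b0' : (0, b) <> 0 :> dsum A B t by case.
have [st|/ltW ts] := leP s t.
  have [ra|//] := dim_le1 t (rep_map A st a) b.
  apply: a0'; apply: (inj _ _ st _ (suppI _ _ b0')).
  by rewrite /= /dsum_map_fun /= ra linear0.
have [//|rb] := dim_le1 s a (rep_map B ts b).
apply: b0'; apply: (inj _ _ ts _ (suppI _ _ a0')).
by rewrite /= /dsum_map_fun /= rb linear0.
Qed.


(** * Splitting off injective subobjects *)

(** Each [x] is [h (r x)] plus [x - h (r x)], and the second term lies in the kernel of the
    retraction [r]. *)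
Lemma isomorphic_dsum_ker M N (h : hom N M) (r : hom M N) :
  (forall t, cancel (h t) (r t)) -> isomorphic M (dsum N (ker_rep r)).
Proof.
move=> hK.
have kerP t x : r t (x - h t (r t x)) = 0 by rewrite linearB hK subrr.
pose p t x : dsum N (ker_rep r) t := (r t x, in_lin_ker (kerP t x)).
have p_lin t : linear (p t).
  move=> a u v; congr pair; first exact: linearP.
  by apply: val_inj; rewrite /= (linearP (r t)) (linearP (h t)) scalerBr opprD addrACA.
have p_nat x y (xy : (x <= y)%O) (v : M x) :
    p y (rep_map M xy v) = rep_map (dsum N (ker_rep r)) xy (p x v).
  congr pair; first exact: hom_nat.
  by apply: val_inj; rewrite /= linearB !hom_nat.
pose q t (x : dsum N (ker_rep r) t) : M t := h t x.1 + val x.2.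
have q_lin t : linear (q t).
  by move=> a u v; rewrite /q /= linearP scalerDr addrACA.
have q_nat x y (xy : (x <= y)%O) v :
    q y (rep_map (dsum N (ker_rep r)) xy v) = rep_map M xy (q x v).
  by rewrite /q /= hom_nat linearD.
exists (@Hom k d T M (dsum N (ker_rep r)) (fun t => linear_of (p_lin t)) p_nat).
exists (@Hom k d T (dsum N (ker_rep r)) M (fun t => linear_of (q_lin t)) q_nat).
split=> t x /=; first by rewrite /q /= addrC subrK.
have rq : r t (q t x) = x.1 by rewrite /q linearD hK lin_ker_valP addr0.
case: x rq => x1 x2 /= rq; congr pair => //.
by apply: val_inj; rewrite /= rq /q /= addrC addKr.
Qed.

(** Injectivity of [N] yields a retraction of [h]. Its kernel is a summand of [M] complementary to
    [N != 0], hence zero. *)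
Lemma isomorphic_injective_subobject M N (h : hom N M) :
    injective_object N -> ~ zero_object N -> indecomposable M ->
  (forall t, injective (h t)) -> isomorphic M N.
Proof.
move=> Ninj N0 [_ Mind] /injective_monomorphism h_mono.
have [r hK'] := Ninj _ _ h h_mono (id_hom N).
have hK s : cancel (h s) (r s) := hK' s.
have [//|ker0] := Mind _ _ (isomorphic_dsum_ker hK).
exists r, h; split=> // t x.
have kerP : r t (h t (r t x) - x) = 0 by rewrite linearB hK subrr.
apply/eqP; rewrite -subr_eq0; apply/eqP.
by move: (congr1 val (ker0 t (in_lin_ker kerP))) => /= ->.
Qed.

(** * Embedding an interval representation into an injective object *)

(* The subrepresentation of [interval_rep k I] generated by [1] at [t]. *)
Definition tail_rep I (t : T) : rep k T.
Proof.
refine (@Rep k d T (fun y => line k ((t <= y)%O && (y \in Idl_set I)))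
  (fun x y _ => line_map k ((t <= x)%O && (x \in Idl_set I))
                         ((t <= y)%O && (y \in Idl_set I))) _ _).
- by move=> x _; apply: line_map_id.
- move=> x y z xy yz _ v; apply: line_map_comp.
  move=> /andP[/andP[tx _] /andP[_ /set_mem Iz]].
  by rewrite (le_trans tx xy) mem_set //; apply: Idl_down Iz.
Defined.

Definition tail_incl I t : hom (tail_rep I t) (interval_rep k I).
Proof.
refine (@Hom k d T (tail_rep I t) (interval_rep k I)
  (fun y => line_map k ((t <= y)%O && (y \in Idl_set I)) (y \in Idl_set I)) _).
move=> x y xy v; apply: interval_val_inj => Iy; have Ix := Idl_down xy Iy.
rewrite line_val_interval_map // (line_val_map _ (mem_set Ix)).
rewrite (line_val_map _ (mem_set Iy)).
have /orP[Px|nPx] := orbN ((t <= x)%O && (x \in Idl_set I)).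
  apply: line_val_map; move/andP: Px => [tx _].
  by rewrite (le_trans tx xy) mem_set.
have -> : v = 0 by apply: line_val_inj; rewrite (line_val_false _ nPx) line_val0.
by rewrite linear0 !line_val0.
Defined.

Lemma tail_incl_inj I t y : injective (tail_incl I t y).
Proof.
move=> u v /(congr1 line_val) uv; apply: line_val_inj.
have /orP[/andP[_ Iy]|nPy] := orbN ((t <= y)%O && (y \in Idl_set I)).
  by move: uv; rewrite !line_val_map.
by rewrite !line_val_false.
Qed.

Section Survival.
Context (M : rep k T) (t : T) (v : M t).

(** Quantifying over the proof of [t <= y] includes all points not above [t], which makes the set
    downward closed. *)
Definition survival : set T :=
  [set y | forall ty : (t <= y)%O, rep_map M ty v <> 0].

(** The default [0] is harmless: [tail_rep] vanishes at points not above [t]. *)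
Definition orbit y : M y :=
  if pselect (t <= y)%O is left ty then rep_map M ty v else 0.

Lemma orbitE y (ty : (t <= y)%O) : orbit y = rep_map M ty v.
Proof. by rewrite /orbit; case: pselect => // ty'; rewrite (bool_irrelevance ty' ty). Qed.

Hypothesis v0 : v <> 0.

Fact survival_neq0 : survival !=set0.
Proof. by exists t => tt; rewrite rep_map_id. Qed.

Fact survival_down x y : (x <= y)%O -> survival y -> survival x.
Proof.
move=> xy Sy tx vx; apply: (Sy (le_trans tx xy)).
by rewrite (rep_map_comp tx xy) vx linear0.
Qed.

Definition survival_ideal : Idl T := MkIdl survival_neq0 survival_down.

Definition orbit_fun y (c : tail_rep survival_ideal t y) : M y :=
  line_val c *: orbit y.

Fact orbit_linear y : linear (@orbit_fun y).
Proof. by move=> a u w; rewrite /orbit_fun line_valP scalerDl scalerA. Qed.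

Fact orbit_nat x y (xy : (x <= y)%O) (c : tail_rep survival_ideal t x) :
  orbit_fun (rep_map (tail_rep survival_ideal t) xy c) =
  rep_map M xy (orbit_fun c).
Proof.
rewrite /orbit_fun linearZ /=.
have /orP[/andP[tx Ix]|nPx] := orbN ((t <= x)%O && (x \in survival)); last first.
  have -> : c = 0 by apply: line_val_inj; rewrite (line_val_false _ nPx) line_val0.
  by rewrite linear0 !line_val0 !scale0r.
have ty := le_trans tx xy.
rewrite !orbitE -(rep_map_comp tx xy ty).
have [Iy|nIy] := pselect (survival y).
  suff -> : line_val (rep_map (tail_rep survival_ideal t) xy c) = line_val c by [].
  by apply: line_val_map; rewrite ty; apply: mem_set.
(* Here [y] has left the ideal, so [v] has died at [y] and both sides vanish. *)
suff -> : rep_map M ty v = 0 by rewrite !scaler0.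
apply: contrapT => vy; apply: nIy => ty'.
by rewrite (bool_irrelevance ty' ty).
Qed.

Definition orbit_hom : hom (tail_rep survival_ideal t) M :=
  @Hom k d T (tail_rep survival_ideal t) M
    (fun y => linear_of (orbit_linear (y := y))) orbit_nat.

(* A morphism to [M] mapping [1] at [t] to [v] kills nothing: every nonzero
   element of [k_I] has a nonzero image at some [y >= t] in [I]. *)
Lemma tail_extension_injective (h : hom (interval_rep k survival_ideal) M) :
  (forall y, h y \o tail_incl survival_ideal t y =1 orbit_hom y) ->
  forall y, injective (h y).
Proof.
move=> h_ext y; suff ker0 c : h y c = 0 -> c = 0.
  move=> c c' hcc'; apply/eqP; rewrite -subr_eq0; apply/eqP/ker0.
  by rewrite linearB hcc' subrr.
move=> hc0; apply: interval_val_inj => Iy.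
(* Essentiality of the tail: [z] is the larger of [y] and [t], and both lie in the ideal. *)
have [z [yz tz Iz]] : exists z, [/\ (y <= z)%O, (t <= z)%O & survival z].
  have [ty|/ltW yt] := leP t y; first by exists y.
  by exists t; split=> // tt; rewrite rep_map_id.
have Pz : (t <= z)%O && (z \in survival) by rewrite tz mem_set.
pose c' : tail_rep survival_ideal t z := line_of (line_val c).
have c'E : rep_map (interval_rep k survival_ideal) yz c =
    tail_incl survival_ideal t z c'.
  apply: interval_val_inj => _; rewrite line_val_interval_map //.
  by rewrite (line_val_map _ (mem_set Iz)) line_ofK.
have := h_ext z c'; rewrite /= -c'E hom_nat hc0 linear0 /orbit_fun orbitE.
rewrite line_ofK // line_val0 => /esym/eqP; rewrite scaler_eq0.
by case/orP=> /eqP // /(Iz tz).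
Qed.

End Survival.

(** * Classification and the bijection with ideals *)

Lemma indecomposable_injective_interval M :
    injective_object M -> indecomposable M ->
  exists I, isomorphic M (interval_rep k I).
Proof.
move=> Minj Mind; have [M0 _] := Mind.
have [t /existsNP[v v0]] : exists t, ~ zero_space (M t) by apply/existsNP.
have [h h_ext] := Minj _ _ _ (injective_monomorphism (@tail_incl_inj _ t))
  (orbit_hom v0).
exists (survival_ideal v0).
apply: (isomorphic_injective_subobject (h := h)) => //.
- exact: injective_interval_rep.
- exact: interval_rep_nonzero.
- exact: tail_extension_injective h_ext.
Qed.

Lemma Idl_ext I J : Idl_set I = Idl_set J -> I = J.
Proof.
case: I J => [I I0 Id] [J J0 Jd] /= IJ; case: _ / IJ J0 Jd => J0 Jd.
by congr MkIdl; apply: Prop_irrelevance.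
Qed.

Lemma Sp_ext (S S' : Sp k T) : Sp_class S = Sp_class S' -> S = S'.
Proof.
case: S S' => [S SP] [S' SP'] /= SS'; case: _ / SS' SP' => SP'.
by congr MkSp; apply: Prop_irrelevance.
Qed.

Lemma interval_rep_inj I J :
  isomorphic (interval_rep k I) (interval_rep k J) -> I = J.
Proof. by move/isomorphic_supp; rewrite !supp_interval_rep => /Idl_ext. Qed.

Definition Sp_interval I : Sp k T := MkSp (ex_intro _ (interval_rep k I)
  (And3 (@injective_interval_rep I) (indecomposable_interval_rep I) erefl)).

Lemma Sp_intervalP (S : Sp k T) : exists I, S = Sp_interval I.
Proof.
have [M [Minj Mind SE]] := Sp_classP S.
have [I MI] := indecomposable_injective_interval Minj Mind.
by exists I; apply: Sp_ext; rewrite SE; apply: isomorphic_class.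
Qed.

End Representations.

Theorem mainTheorem4 (k : fieldType) (d : Order.disp_t) (T : orderType d) :
  (forall M N : rep k T,
     injective_object M -> indecomposable M ->
     injective_object N -> indecomposable N ->
     supp M = supp N -> isomorphic M N) /\
  (exists (suppSp : Sp k T -> Idl T) (Delta : Idl T -> Sp k T),
     [/\ forall (S : Sp k T) (M : rep k T), S M -> suppSp S = supp M :> set T,
         bijective suppSp,
         forall I : Idl T, Sp_class (Delta I) = isomorphic (interval_rep k I),
         cancel suppSp Delta
       & cancel Delta suppSp]).
Proof.
split.
  move=> M N Mi Md Ni Nd MN.
  have [I MI] := indecomposable_injective_interval Mi Md.
  have [J NJ] := indecomposable_injective_interval Ni Nd.
  apply: (isomorphic_trans MI); apply: isomorphic_sym.
  suff -> : I = J by [].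
  apply: Idl_ext; rewrite -(supp_interval_rep (k := k) I).
  by rewrite -(isomorphic_supp MI) MN (isomorphic_supp NJ) supp_interval_rep.
(* The ideal is picked by choice; [interval_rep_inj] shows below that it is unique. *)
pose suppSp S := projT1 (cid (@Sp_intervalP k d T S)).
have suppSpK : cancel suppSp (@Sp_interval k d T).
  by move=> S; rewrite /suppSp; case: cid.
have SpK : cancel (@Sp_interval k d T) suppSp.
  (* Equal points of [Sp] have equal class predicates; reflexivity at [k_J] then gives an
     isomorphism from [k_I] to [k_J]. *)
  move=> I; rewrite /suppSp; case: cid => J /= /(congr1 (@Sp_class k d T)) /= IJ.
  by apply/esym/(interval_rep_inj (k := k)); rewrite IJ; apply: isomorphic_refl.
exists suppSp, (@Sp_interval k d T); split=> //; last by exists (@Sp_interval k d T).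
move=> S M; rewrite -{1}(suppSpK S) => /isomorphic_supp <-.
by rewrite supp_interval_rep.
Qed.
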